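(* Distributional chaos in a sequence (SDC) and distributional chaos of type 3 (DC3) do not imply each other. That is: (i) there exist a metric space $X$ and a continuous map $f\colon X\to X$ that is SDC but not DC3; and (ii) there exist a metric space $Y$ and a continuous map $g\colon Y\to Y$ that is DC3 but not SDC.
   Context: Let $(X,d)$ be a metric space and $f\colon X\to X$ continuous; $f^n$ denotes the $n$-fold iterate of $f$ and $\#$ denotes cardinality. For $x,y\in X$ and $t>0$ put $$F(f,x,y,t)=\liminf_{n\to\infty}\frac1n\#\{i : d(f^i(x),f^i(y))<t,\ 0\le i<n\},$$ $$F^*(f,x,y,t)=\limsup_{n\to\infty}\frac1n\#\{i : d(f^i(x),f^i(y))<t,\ 0\le i<n\}.$$ The map $f$ is distributionally chaotic of type 3 (DC3) if there exists an uncountable subset $S\subseteq X$ such that for every pair $x,y\in S$ of distinct points, $F(f,x,y,t)<F^*(f,x,y,t)$ for all $t\in J$, where $J$ is some nondegenerate interval. For a strictly increasing sequence $\{q_i\}_{i\ge0}$ of positive integers put $$F(f,x,y,t,q_i)=\liminf_{n\to\infty}\frac1n\#\{i : d(f^{q_i}(x),f^{q_i}(y))<t,\ 0\le i<n\},$$ $$F^*(f,x,y,t,q_i)=\limsup_{n\to\infty}\frac1n\#\{i : d(f^{q_i}(x),f^{q_i}(y))<t,\ 0\le i<n\}.$$ The map $f$ is distributionally chaotic in a sequence (SDC) if, for some such sequence $\{q_i\}$, there exists an uncountable subset $S\subseteq X$ such that for every pair $x,y\in S$ of distinct points, $F(f,x,y,\varepsilon,q_i)=0$ for some $\varepsilon>0$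 and $F^*(f,x,y,t,q_i)=1$ for all $t>0$. *)

(* Defs.v *)
From HB Require Import structures.
From mathcomp Require Import all_boot all_order all_algebra.
From mathcomp Require Import all_classical all_reals all_analysis.

Set Implicit Arguments.
Unset Strict Implicit.
Unset Printing Implicit Defensive.

Import Order.TTheory GRing.Theory Num.Theory.
Import numFieldNormedType.Exports.

Local Open Scope classical_set_scope.
Local Open Scope ring_scope.

Section DistributionFunctions.
Context {R : realType} {X : metricType R}.
Implicit Types (f : X -> X) (x y : X) (t : R) (q : nat -> nat).

(* The value at n = 0 is 0 (as 0^-1 = 0); it is irrelevant to the limits.
   The sequence takes values in [0, 1], so the real-valued [limn_inf] and
   [limn_sup] below are the genuine lower and upper limits. *)
Definition freq_seq f x y t q (n : nat) : R :=
  #|[pred i : 'I_n | mdist (iter (q i) f x) (iter (q i) f y) < t]|%:R / n%:R.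

Definition lower_distr_seq f x y t q : R := limn_inf (freq_seq f x y t q).

Definition upper_distr_seq f x y t q : R := limn_sup (freq_seq f x y t q).

Definition freq f x y t (n : nat) : R :=
  #|[pred i : 'I_n | mdist (iter i f x) (iter i f y) < t]|%:R / n%:R.

Definition lower_distr f x y t : R := limn_inf (freq f x y t).

Definition upper_distr f x y t : R := limn_sup (freq f x y t).

End DistributionFunctions.

Definition nondegenerate_interval {R : realType} (J : set R) : Prop :=
  is_interval J /\ exists a b : R, [/\ J a, J b & a < b].

(* The interval J may depend on the pair (x, y), as epsilon does in [SDC];
   it lies in the positive reals, where the distribution functions are
   considered. *)
Definition DC3 {R : realType} {X : metricType R} (f : X -> X) : Prop :=
  exists S : set X, ~ countable S /\
    forall x y : X, S x -> S y -> x <> y ->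
      exists J : set R,
        [/\ nondegenerate_interval J,
            forall t, J t -> 0 < t
          & forall t, J t -> lower_distr f x y t < upper_distr f x y t].

Definition SDC {R : realType} {X : metricType R} (f : X -> X) : Prop :=
  exists q : nat -> nat,
    [/\ {homo q : i j / (i < j)%N},
        forall i, (0 < q i)%N
      & exists S : set X, ~ countable S /\
          forall x y : X, S x -> S y -> x <> y ->
            (exists2 e : R, 0 < e & lower_distr_seq f x y e q = 0) /\
            (forall t : R, 0 < t -> upper_distr_seq f x y t q = 1)].

(* Main.v *)
Require Import Defs.
From HB Require Import structures.
From mathcomp Require Import all_boot all_order all_algebra.
From mathcomp Require Import all_classical all_reals all_analysis.
From mathcomp Require Import lra zify.

(** Both examples are towers: the space [R * nat], whose points are written
    [(s, n)] and where [n] is called the level, with the map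
    [(s, n) |-> (s, n.+1)].  Distinct points on the same level [n] are at
    distance [phi n], with [0 < phi n <= 1], and points on different levels are
    at distance 1.  This is an ultrametric inducing the discrete topology, so
    the map is continuous, and the distance between the orbits of two distinct
    points of level 0 runs through [phi 0, phi 1, phi 2, ...], whatever the
    points: all distribution functions are read off [phi].  Level 0 is
    uncountable and serves as the scrambled set.

    The basic ingredient is a set of integers of lower density 0 and upper
    density 1: the union of every other block of the partition of the integers
    from 2 on into the intervals [2^(2^k), 2^(2^(k+1))), each of which is much
    longer than all of its predecessors together ([phase_density]).

    - DC3 but not SDC: let [phi] be 1/2 on this set and 1 elsewhere.  For
      [1/2 < t < 1] the lower and upper distribution functions are 0 and 1; but no
      two distinct points are closer than 1/2, so no pair is proximal along any
      sequence.

    - SDC but not DC3: let [phi (2^i)] be [1/(i+1)] when [i] is in this set, and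
      let [phi] be 1 everywhere else.  Along [q i = 2^i] the pairs are
      distributionally scrambled.  Along the full orbit, however, the powers of
      2 have density zero ([density_pow2]), so the distribution functions of
      every pair of distinct points are both 0 up to [t = 1] and both 1
      afterwards. *)

Set Implicit Arguments.
Unset Strict Implicit.
Unset Printing Implicit Defensive.

Import Order.TTheory GRing.Theory Num.Theory.
Import numFieldNormedType.Exports.

Local Open Scope classical_set_scope.
Local Open Scope ring_scope.

(** * Densities of sets of integers *)

Section Density.
Variable R : realType.
Implicit Types (P Q : pred nat) (u : nat -> R).

Definition density P (n : nat) : R := #|[pred i : 'I_n | P i]|%:R / n%:R.

Lemma density_ge0 P n : 0 <= density P n.
Proof. by rewrite /density divr_ge0. Qed.

Lemma density_le1 P n : density P n <= 1.
Proof.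
rewrite /density; case: n => [|n]; first by rewrite invr0 mulr0.
rewrite ler_pdivrMr ?ltr0n// mul1r ler_nat.
by rewrite -[leqRHS]card_ord max_card.
Qed.

Lemma densityC P n : (0 < n)%N -> density (predC P) n = 1 - density P n.
Proof.
move=> n0; have nn0 : n%:R != 0 :> R by rewrite pnatr_eq0 -lt0n.
apply/eqP; rewrite eq_sym subr_eq /density -mulrDl -natrD addnC.
have -> : #|[pred i : 'I_n | predC P i]| = #|predC [pred i : 'I_n | P i]|.
  exact: eq_card.
by rewrite cardC card_ord divff.
Qed.

Lemma limn_sup_eq1 u : (forall n, u n <= 1) ->
  (forall e N, 0 < e -> exists2 n, (N <= n)%N & 1 - e <= u n) ->
  limn_sup u = 1.
Proof.
move=> u1 ue; rewrite /limn_sup (_ : sups u = fun=> 1) ?lim_cst//.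
apply/funext => N; rewrite /sups /=.
have ub1 : ubound (sdrop u N) 1 by move=> _ [n _ <-].
apply/eqP; rewrite eq_le; apply/andP; split.
  by apply: ge_sup => //; exists (u N); exists N => /=.
apply/ler_addgt0Pr => e e0; rewrite -lerBlDr.
have [n Nn une] := ue e N e0; apply: le_trans une _.
by apply: ub_le_sup; [exists 1 | exists n].
Qed.

Lemma limn_inf_eq0 u : (forall n, 0 <= u n) ->
  (forall e N, 0 < e -> exists2 n, (N <= n)%N & u n <= e) ->
  limn_inf u = 0.
Proof.
move=> u0 ue; rewrite /limn_inf (_ : infs u = fun=> 0) ?lim_cst//.
apply/funext => N; rewrite /infs /=.
have lb0 : lbound (sdrop u N) 0 by move=> _ [n _ <-].
apply/eqP; rewrite eq_le; apply/andP; split; last first.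
  by apply: lb_le_inf => //; exists (u N); exists N => /=.
apply/ler_addgt0Pr => e e0; rewrite add0r.
have [n Nn une] := ue e N e0; apply: le_trans une.
by apply: ge_inf; [exists 0 | exists n].
Qed.

Lemma card_ord_le_inj n m Q (g : nat -> nat) :
  {in Q &, injective g} -> (forall i, (i < n)%N -> Q i -> (g i < m)%N) ->
  (#|[pred i : 'I_n | Q i]| <= m)%N.
Proof.
move=> g_inj gm; set A := [pred i : 'I_n | Q i].
rewrite cardE -(size_map (fun i : 'I_n => g i)) -(size_iota 0 m).
apply: uniq_leq_size => [|_ /mapP[i iA ->]].
  rewrite map_inj_in_uniq ?enum_uniq// => i j.
  by rewrite !mem_enum => iA jA /g_inj gij; apply/val_inj/gij.
by rewrite mem_iota add0n /= gm//; rewrite mem_enum in iA.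
Qed.

(** For [2 <= i], the parity of the index [k] of the block
    [2^(2^k), 2^(2^(k+1))) that contains [i]. *)
Definition phase (i : nat) : bool := odd (trunc_log 2 (trunc_log 2 i)).

Lemma phase_block k i : (2 ^ 2 ^ k <= i < 2 ^ 2 ^ k.+1)%N -> phase i = odd k.
Proof.
move=> /andP[lo hi]; congr odd; apply: trunc_log_eq => //.
rewrite trunc_log_max//= -(ltn_exp2l _ _ (ltnSn 1)).
by apply: leq_ltn_trans hi; rewrite trunc_logP// (leq_trans _ lo)// expn_gt0.
Qed.

(** With [m = 2^(2^k)], block number [k] is the interval [m, m^2).  At its end
    a set containing it misses at most [m] of the first [m^2] integers, so its
    frequency is at least [1 - 1/m].  The threshold [N0] allows for sets that
    contain only the late blocks, such as the times at which [1/(i+1)] lies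
    below a given [t]. *)
Lemma phase_density b P N0 : (forall i, (N0 <= i)%N -> phase i = b -> P i) ->
  forall e N, 0 < e -> exists2 n, (N < n)%N & 1 - e <= density P n.
Proof.
move=> phaseP e N e0.
pose k0 := (N0 + N + Num.truncn e^-1)%N; pose k := (k0.*2 + b)%N.
(* [k] has the parity [b] and is at least [N0], [N] and about [1/e]. *)
have oddk : odd k = b by rewrite oddD odd_double oddb.
pose m := (2 ^ 2 ^ k)%N.
have km : (k < m)%N by rewrite (@ltn_trans (2 ^ k))// ltn_expl.
have k0k : (k0 <= k)%N by rewrite /k; lia.
have m0 : (0 < m)%N by rewrite expn_gt0.
have nE : (2 ^ 2 ^ k.+1 = m * m)%N by rewrite mulnn -expnM -expnSr.
exists (m * m)%N; first by nia.
rewrite lerBlDl -lerBlDr -densityC ?muln_gt0 ?m0//.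
apply: (@le_trans _ _ (m%:R / (m * m)%:R)).
  rewrite ler_wpM2r ?invr_ge0// ler_nat.
  apply: (@card_ord_le_inj _ _ (predC P) id) => [//|i imm /= /negP nPi].
  rewrite ltnNge; apply/negP => mi; apply: nPi; apply: phaseP; first by lia.
  by rewrite -oddk; apply: phase_block; rewrite nE -/m mi imm.
rewrite natrM invfM mulrA divff ?pnatr_eq0 -?lt0n// mul1r.
rewrite invf_ple ?posrE ?ltr0n//.
apply: (le_trans (ltW (truncnS_gt _))); rewrite ler_nat.
by rewrite (leq_ltn_trans _ km)// (leq_trans _ k0k)// leq_addl.
Qed.

Lemma limn_sup_phase P N0 : (forall i, (N0 <= i)%N -> phase i -> P i) ->
  limn_sup (density P) = 1.
Proof.
move=> phaseP; apply: limn_sup_eq1 => [n|e N e0]; first exact: density_le1.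
by have [n /ltnW] := phase_density phaseP N e0; exists n.
Qed.

Lemma limn_inf_phase P : (forall i, P i -> phase i) ->
  limn_inf (density P) = 0.
Proof.
move=> Pphase; apply: limn_inf_eq0 => [n|e N e0]; first exact: density_ge0.
have nphase i : (0 <= i)%N -> phase i = false -> predC P i.
  by move=> _ /= phiF; apply/negP => /Pphase; rewrite phiF.
have [n Nn ne] := phase_density nphase N e0; exists n; first exact: ltnW.
by move: ne; rewrite densityC ?(leq_ltn_trans _ Nn)// lerD2l lerN2.
Qed.

Definition is_pow2 (n : nat) : bool := n == (2 ^ trunc_log 2 n)%N.

Lemma sqrS_le_exp2 j : (j.+1 ^ 2 <= 4 * 2 ^ j)%N.
Proof.
elim: j => // -[|[|j]] // IH; rewrite [(2 ^ _.+3)%N]expnS; lia.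
Qed.

(** Below [c + n] there are at most [l = O(log n)] powers of 2, for which the
    crude bound [l^2 <= 8 n] is enough. *)
Lemma density_pow2 P c : (forall i, P i -> is_pow2 (c + i)) ->
  density P @ \oo --> (0 : R).
Proof.
move=> Ppow2; apply/cvgr0Pnorm_le => e e0.
near=> n; rewrite ger0_norm ?density_ge0//.
have n0 : (0 < n)%N by near: n; exists 1%N.
have cn : (c <= n)%N by near: n; exists c.
have ne : 8 < e ^+ 2 * n%:R.
  rewrite mulrC -ltr_pdivrMr ?exprn_gt0//.
  by near: n; exact: nbhs_infty_gtr.
rewrite /density ler_pdivrMr ?ltr0n//.
pose l := (trunc_log 2 (c + n)).+1.
have card_l : (#|[pred i : 'I_n | P i]| <= l)%N.
  apply: (@card_ord_le_inj _ _ P (fun i => trunc_log 2 (c + i))%N).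
    move=> i j /Ppow2/eqP ci /Ppow2/eqP cj eq_log.
    by apply: (@addnI c); rewrite ci cj eq_log.
  by move=> i ilt _; rewrite ltnS leq_trunc_log// leq_add2l ltnW.
have l_sqr : (l ^ 2 <= 8 * n)%N.
  have := sqrS_le_exp2 (trunc_log 2 (c + n)).
  have := @trunc_logP 2 (c + n) isT; rewrite /l; lia.
apply: (@le_trans _ _ l%:R); first by rewrite ler_nat.
rewrite -(ler_pXn2r (n := 2)) ?nnegrE ?mulr_ge0 ?(ltW e0)//.
rewrite exprMn -natrX (le_trans (y := (8 * n)%:R))// ?ler_nat//.
by rewrite natrM expr2 [n%:R ^+ 2]expr2 mulrA ler_wpM2r// -expr2 ltW.
Unshelve. all: by end_near. Qed.

End Density.

Lemma freq_seqE (R : realType) (X : metricType R) (f : X -> X) x y t q :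
  freq_seq f x y t q =
  density R (fun i => mdist (iter (q i) f x) (iter (q i) f y) < t).
Proof. by []. Qed.

Lemma freqE (R : realType) (X : metricType R) (f : X -> X) x y t :
  freq f x y t = density R (fun i => mdist (iter i f x) (iter i f y) < t).
Proof. by []. Qed.

(** * Towers *)

(** The bounds on [phi] are a parameter of the type, since the metric attached
    to it below needs them. *)
Definition tower (R : realType) (phi : nat -> R)
  of (forall n, 0 < phi n <= 1) : Type := (R * nat)%type.

Section Tower.
Variables (R : realType) (phi : nat -> R) (phi01 : forall n, 0 < phi n <= 1).

Local Notation T := (tower phi01).

HB.instance Definition _ := Choice.copy T (R * nat)%type.

Implicit Types x y z : T.

Definition tower_dist x y : R :=
  if x == y then 0 else if x.2 == y.2 then phi x.2 else 1.

Lemma phi_gt0 n : 0 < phi n. Proof. by case/andP: (phi01 n). Qed.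

Lemma phi_le1 n : phi n <= 1. Proof. by case/andP: (phi01 n). Qed.

Lemma tower_dist_ge0 x y : 0 <= tower_dist x y.
Proof.
by rewrite /tower_dist; do 2 case: ifP => // _; rewrite ltW ?phi_gt0.
Qed.

Lemma tower_dist_le1 x y : tower_dist x y <= 1.
Proof. by rewrite /tower_dist; do 2 case: ifP => // _; rewrite phi_le1. Qed.

Lemma tower_distxx x : tower_dist x x = 0.
Proof. by rewrite /tower_dist eqxx. Qed.

(** Every point is isolated, so that every self-map of the tower is
    continuous. *)
Lemma tower_dist_lt_phi x y : tower_dist x y < phi x.2 -> x = y.
Proof.
rewrite /tower_dist; case: eqP => // _; case: ifP => _; first by rewrite ltxx.
by rewrite ltNge phi_le1.
Qed.

Lemma tower_dist_eq0 x y : tower_dist x y = 0 -> x = y.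
Proof. by move=> xy0; apply: tower_dist_lt_phi; rewrite xy0 phi_gt0. Qed.

Lemma tower_distC x y : tower_dist x y = tower_dist y x.
Proof.
by rewrite /tower_dist eq_sym; case: eqP => // _; rewrite eq_sym; case: eqP => // ->.
Qed.

Lemma tower_dist_triangle y x z :
  tower_dist x z <= tower_dist x y + tower_dist y z.
Proof.
have [->|xy] := eqVneq x y; first by rewrite tower_distxx add0r.
have [<-|yz] := eqVneq y z; first by rewrite tower_distxx addr0.
have [xy2|xy2] := eqVneq x.2 y.2; last first.
  rewrite {2}/tower_dist (negbTE xy) (negbTE xy2).
  by rewrite (le_trans (tower_dist_le1 x z))// lerDl tower_dist_ge0.
have [yz2|yz2] := eqVneq y.2 z.2; last first.
  rewrite {3}/tower_dist (negbTE yz) (negbTE yz2).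
  by rewrite (le_trans (tower_dist_le1 x z))// lerDr tower_dist_ge0.
rewrite /tower_dist (negbTE xy) (negbTE yz) xy2 yz2 eqxx.
by case: ifP => _; have := phi_gt0 z.2; lra.
Qed.

HB.instance Definition _ := isMetric.Build R T
  tower_distxx tower_dist_eq0 tower_distC tower_dist_triangle.

Definition climb (x : T) : T := (x.1, x.2.+1).

Lemma continuous_climb : continuous climb.
Proof.
move=> x A /nbhs_singleton Ax; apply/nbhs_ballP.
exists (phi x.2) => /=; first exact: phi_gt0.
by move=> y; rewrite ballEmdist /= => /tower_dist_lt_phi <-.
Qed.

Lemma iter_climb n x : iter n climb x = (x.1, (x.2 + n)%N).
Proof.
elim: n => [|n IH] /=; first by rewrite addn0 -surjective_pairing.
by rewrite IH /climb /= addnS.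
Qed.

Lemma mdist_climb n x y : x <> y ->
  mdist (iter n climb x) (iter n climb y) =
  if x.2 == y.2 then phi (x.2 + n) else 1.
Proof.
move=> xy; rewrite !iter_climb -[mdist]/tower_dist /tower_dist /=.
rewrite eqn_add2r ifF//; apply/negbTE/eqP => -[xy1 /addIn xy2]; apply: xy.
by rewrite (surjective_pairing x) (surjective_pairing y) xy1 xy2.
Qed.

Definition ground : set T := [set x | x.2 = 0%N].

(** A countable ground level would make the unit interval Lebesgue-null. *)
Lemma uncountable_ground : ~ countable ground.
Proof.
move=> /countable_injP[f f_inj].
have : countable [set: R].
  apply/countable_injP; exists (fun s => f (s, 0%N)) => s s' _ _.
  by move=> /f_inj; rewrite !inE => /(_ erefl erefl) [].
move=> /(sub_countable (subset_card_le (@subsetT _ `[0%R, 1%R]))).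
move=> /countable_lebesgue_measure0/eqP.
by rewrite lebesgue_measure_itv /= lte_fin ltr01 oppr0 adde0 onee_eq0.
Qed.

End Tower.

Lemma uncountable_neq (T : Type) (S : set T) : ~ countable S ->
  exists x y, [/\ S x, S y & x <> y].
Proof.
move=> uncS; apply: contrapT => allS; apply: uncS.
have [S0|/set0P[x Sx]] := eqVneq S set0; first by rewrite S0; exact: countable0.
rewrite (_ : S = [set x]); first exact: countable1.
apply/seteqP; split=> [y Sy|_ ->//].
by apply: contrapT => yx; apply: allS; exists y, x.
Qed.

(** * The two examples *)

Section Examples.
Variable R : realType.

Definition sparse_phi (n : nat) : R :=
  if is_pow2 n && phase (trunc_log 2 n) then (trunc_log 2 n).+1%:R^-1 else 1.

Lemma sparse_phi01 n : 0 < sparse_phi n <= 1.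
Proof.
rewrite /sparse_phi; case: ifP => _; last by rewrite ltr01 lexx.
by rewrite invr_gt0 ltr0n invf_le1 ?ltr0n// ler1n.
Qed.

Lemma sparse_phi_pow2 i :
  sparse_phi (2 ^ i) = if phase i then i.+1%:R^-1 else 1.
Proof. by rewrite /sparse_phi /is_pow2 trunc_expnK// eqxx. Qed.

Definition blocks_phi (n : nat) : R := if phase n then 2^-1 else 1.

Lemma blocks_phi01 n : 0 < blocks_phi n <= 1.
Proof. by rewrite /blocks_phi; case: ifP => _; lra. Qed.

Lemma sparse_SDC : SDC (@climb R _ sparse_phi01).
Proof.
exists (fun i => 2 ^ i)%N.
split=> [i j|i|]; [by rewrite ltn_exp2l|by rewrite expn_gt0|].
exists (@ground R _ sparse_phi01); split; first exact: uncountable_ground.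
move=> x y x0 y0 xy.
have distE i : mdist (iter (2 ^ i) (@climb R _ sparse_phi01) x)
    (iter (2 ^ i) (@climb R _ sparse_phi01) y) =
    if phase i then i.+1%:R^-1 else 1.
  by rewrite mdist_climb// x0 y0 eqxx add0n sparse_phi_pow2.
split.
  exists 1 => //; rewrite /lower_distr_seq freq_seqE.
  apply: limn_inf_phase => i.
  by rewrite distE; case: ifP => // _; rewrite ltxx.
move=> t t0; rewrite /upper_distr_seq freq_seqE.
apply: (@limn_sup_phase _ _ (Num.truncn t^-1)) => i it phi_i.
rewrite distE phi_i invf_plt ?posrE//.
by apply: lt_le_trans (truncnS_gt _) _; rewrite ler_nat.
Qed.

(** The frequencies of every pair of distinct points converge: iterates at
    distance less than 1 occur only when the level is a power of 2, that is,
    with density zero, and no distance exceeds 1. *)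
Lemma sparse_not_DC3 : ~ DC3 (@climb R _ sparse_phi01).
Proof.
move=> [S [/uncountable_neq[x [y [Sx Sy xy]]] /(_ x y Sx Sy xy)]].
move=> [J [[_ [t [_ [Jt _ _]]]] Jpos /(_ t Jt)]].
suff [l fl] : exists l : R, freq (@climb R _ sparse_phi01) x y t @ \oo --> l.
  by rewrite /lower_distr /upper_distr !(cvg_limn_inf_sup fl) ltxx.
have [t1|t1] := leP t 1.
  exists 0; rewrite freqE; apply: (@density_pow2 _ _ x.2) => i.
  rewrite mdist_climb//.
  case: ifP => _; last by rewrite ltNge t1.
  by rewrite /sparse_phi; case: ifP => [/andP[]//|_]; rewrite ltNge t1.
exists 1; apply: cvg_near_cst.
near=> n; rewrite /freq (eq_card (B := 'I_n)) ?card_ord.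
  by rewrite divff// pnatr_eq0 -lt0n; near: n; exists 1%N.
by move=> i; rewrite !inE (le_lt_trans _ t1)// tower_dist_le1.
Unshelve. all: by end_near. Qed.

Lemma blocks_DC3 : DC3 (@climb R _ blocks_phi01).
Proof.
exists (@ground R _ blocks_phi01); split; first exact: uncountable_ground.
move=> x y x0 y0 xy; exists `]2^-1, 1[%classic; split.
- split; first exact: interval_is_interval.
  by exists (3 / 5), (4 / 5); split; rewrite /= ?in_itv /=; lra.
- by move=> t /=; rewrite in_itv /= => /andP[]; lra.
move=> t /=; rewrite in_itv /= => /andP[t2 t1].
have distE i : (mdist (iter i (@climb R _ blocks_phi01) x)
    (iter i (@climb R _ blocks_phi01) y) < t) = phase i.
  rewrite mdist_climb// x0 y0 eqxx add0n /blocks_phi.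
  by case: ifP => _ //; apply/negbTE; rewrite -leNgt ltW.
rewrite /lower_distr /upper_distr freqE.
rewrite limn_inf_phase; last by move=> i; rewrite distE.
by rewrite (@limn_sup_phase _ _ 0)// => i _; rewrite distE.
Qed.

(** Distinct points stay at distance at least 1/2, so the upper distribution
    function at 1/2 is 0 along every sequence. *)
Lemma blocks_not_SDC : ~ SDC (@climb R _ blocks_phi01).
Proof.
move=> [q [_ _ [S [/uncountable_neq[x [y [Sx Sy xy]]] /(_ x y Sx Sy xy)]]]].
have half_gt0 : (0 : R) < 2^-1 by rewrite invr_gt0 ltr0n.
move=> [_ /(_ _ half_gt0)/eqP]; apply/negP.
rewrite /upper_distr_seq (_ : freq_seq _ _ _ _ _ = fun=> 0).
  by rewrite (cvg_limn_inf_sup (cvg_cst 0)).2 eq_sym oner_neq0.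
apply/funext => n; rewrite /freq_seq eq_card0 ?mul0r// => i.
rewrite !inE; apply/negbTE; rewrite -leNgt mdist_climb// /blocks_phi.
by case: ifP => _; [case: ifP => _|]; lra.
Qed.

End Examples.

Theorem theorem5 (R : realType) :
  (exists (X : metricType R) (f : X -> X),
     continuous f /\ SDC f /\ ~ DC3 f) /\
  (exists (Y : metricType R) (g : Y -> Y),
     continuous g /\ DC3 g /\ ~ SDC g).
Proof.
split.
- exists (tower (@sparse_phi01 R)), (@climb R _ _).
  split; first exact: continuous_climb.
  by split; [exact: sparse_SDC|exact: sparse_not_DC3].
- exists (tower (@blocks_phi01 R)), (@climb R _ _).
  split; first exact: continuous_climb.
  by split; [exact: blocks_DC3|exact: blocks_not_SDC].
Qed.
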